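(* Let $A\in\mathbb{R}^{n\times n}$ be a symmetric matrix with nonnegative entries. Then \[ \rho_{\mathrm{per}}(A)+\eta_{\mathrm{per}}(A)=n . \]
   Context: For an $m\times m$ matrix $B$, $\mathrm{per}(B)=\sum_{\sigma\in S_m}\prod_i b_{i,\sigma(i)}$. The permanental rank $\rho_{\mathrm{per}}(A)$ is the largest integer $k$ such that $A$ has a $k\times k$ submatrix $A[I,J]$ (rows $I$, columns $J$, $|I|=|J|=k$) with nonzero permanent. The permanental nullity $\eta_{\mathrm{per}}(A)$ is the multiplicity of $0$ as a root of the permanental polynomial $\pi(A,x)=\mathrm{per}(A-xI)$. *)

(* Defs.v *)
From mathcomp Require Export all_boot all_order all_fingroup all_algebra.
From mathcomp Require Export reals.

Set Implicit Arguments.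
Unset Strict Implicit.
Unset Printing Implicit Defensive.

Import Order.TTheory GRing.Theory Num.Theory.
Local Open Scope ring_scope.

Definition permanent (R : comNzRingType) (m : nat) (B : 'M[R]_m) : R :=
  \sum_(s : 'S_m) \prod_(i < m) B i (s i).

(* enum_val lists the elements of I and J in increasing order. *)
Definition submx_of (R : comNzRingType) (n : nat) (A : 'M[R]_n)
    (I J : {set 'I_n}) : 'M[R]_(#|I|, #|J|) :=
  mxsub (fun i : 'I_#|I| => enum_val i) (fun j : 'I_#|J| => enum_val j) A.

(* conform_mx only casts A[I, J] to type 'M_k: its default value 0 is never
   used, because both dimensions are required to be k. *)
Definition has_per_submx (R : comNzRingType) (n : nat) (A : 'M[R]_n)
    (k : nat) : bool :=
  [exists I : {set 'I_n}, exists J : {set 'I_n},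
    [&& #|I| == k, #|J| == k &
        permanent (conform_mx (0 : 'M[R]_k) (submx_of A I J)) != 0]].

(* The maximum is over a nonempty set: the empty submatrix has permanent 1. *)
Definition per_rank (R : comNzRingType) (n : nat) (A : 'M[R]_n) : nat :=
  (\max_(k < n.+1 | has_per_submx A k) k)%N.

Definition per_poly (R : comNzRingType) (n : nat) (A : 'M[R]_n) : {poly R} :=
  permanent (map_mx polyC A - 'X%:M).

Definition per_nullity (R : fieldType) (n : nat) (A : 'M[R]_n) : nat :=
  mup 0 (per_poly A).

(* Main.v *)
Require Import Defs.
From mathcomp Require Import primitive_action alt.

Set Implicit Arguments.
Unset Strict Implicit.
Unset Printing Implicit Defensive.

Import Order.TTheory GRing.Theory Num.Theory.
Local Open Scope ring_scope.

(** Expanding [per(A - xI)] over permutations, the term of [s] vanishes unless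
[s] fixes every [i] with [A i (s i) = 0]; otherwise it is [(-x)^z] times a
polynomial whose constant term is positive, where [z] counts these [i]. The
signs agree within each order [z], so nothing cancels in the lowest one, and
the nullity is the least such [z]. It remains to see that some nonzero
permanental minor of maximal size is principal: a maximal partial matching [s]
from rows [I] gives, by symmetry of [A], a matching onto columns [I]; as in the
proof of the Cantor-Bernstein theorem (Mendelsohn-Dulmage), the two combine
into a matching that covers both rows [I] and columns [I], and maximality
forces it to be a permutation of [I]. *)

(** The symmetric group of [T] is [k]-transitive for all [k] up to [#|T|]. This turns a matching
    between enumerated rows and columns into one permutation of all indices. *)
Lemma perm_extend_inj (T : finType) (k : nat) (f g : 'I_k -> T) :
  injective f -> injective g -> exists s : {perm T}, forall i, s (f i) = g i.
Proof.
move=> f_inj g_inj.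
have k_le : (k <= #|T|)%N by rewrite -[k]card_ord -(card_codom f_inj) max_card.
have tr_k := ntransitive_weak k_le (Sym_trans T).
have dtuple (h : 'I_k -> T) : injective h ->
    [tuple h i | i < k] \in k.-dtuple(setT).
  move=> h_inj; apply/dtuple_onP; split=> [i j|i]; last by rewrite inE.
  by rewrite !tnth_mktuple => /h_inj.
have [s _ gE] := atransP2 tr_k (dtuple f f_inj) (dtuple g g_inj).
exists s => i; have := congr1 (fun t => tnth t i) gE.
by rewrite tnth_mktuple tnth_map tnth_mktuple.
Qed.

Lemma symmetric_matching_cover (T : finType) (e : rel T) (s : {perm T})
    (I : {set T}) :
    symmetric e -> {in I, forall i, e i (s i)} ->
  exists (D : {set T}) (h : T -> T),
    [/\ I \subset D, I \subset h @: D, {in D &, injective h} &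
        {in D, forall x, e x (h x)}].
Proof.
move=> e_sym e_s; pose J := s @: I.
(* View rows and columns as two copies of [T]. The least fixed point [C] of [F] consists of the rows
   reached from rows outside [J] by paths alternating between [s] on [I] and its transpose, which
   matches row [s i] with column [i]. *)
pose F (X : {set T}) :=
  ~: J :|: [set s (s c) | c in X & (c \in I) && (s c \in I)].
have F_mono : {homo F : X Y / X \subset Y}.
  move=> X Y /subsetP XY; apply/setUS/subsetP => x /imsetP[c].
  rewrite inE => /andP[cX cI] ->; apply/imsetP; exists c => //.
  by rewrite inE XY.
have /setP FC := fixsetK F_mono; move: (fixset F) FC => C FC.
have C_next x : x \in C -> x \in I -> s x \in I -> s (s x) \in C.
  move=> xC xI sxI; rewrite -FC inE; apply/orP; right.
  by apply/imsetP; exists x; rewrite // inE xC xI sxI.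
have notC_J x : x \notin C -> x \in J.
  by rewrite -FC !inE negb_or negbK => /andP[].
have J_inv x : x \in J -> (s^-1)%g x \in I.
  by case/imsetP=> y yI ->; rewrite permK.
(* Rows in [C] follow [s], the others follow the transpose. *)
pose h x := if x \in C then s x else (s^-1)%g x.
pose D := I :|: (J :\: C).
have D_C x : x \in D -> x \in C -> x \in I.
  by rewrite !inE => /orP[//|/andP[/negPf->]].
(* A shared column would give [y = s (s x)], which is in [C] because [x] is. *)
have h_cross x y : x \in D -> x \in C -> y \notin C -> s x <> (s^-1)%g y.
  move=> xD xC yNC sxy.
  have sxI : s x \in I by rewrite sxy J_inv ?notC_J.
  by have := C_next x xC (D_C x xD xC) sxI; rewrite sxy permKV (negPf yNC).
exists D, h; split.
- exact: subsetUl.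
- apply/subsetP => y yI; have syJ : s y \in J by apply: imset_f.
  (* The transpose matches row [s y] with column [y]. If that row is in [C], it was reached through
     column [y] from some row [c] in [C], and [s] matches [c] with [y]. *)
  have [syC | syNC] := boolP (s y \in C).
    move: syC; rewrite -FC !inE syJ /= => /imsetP[c].
    rewrite inE => /and3P[cC cI _] /perm_inj ->.
    by apply/imsetP; exists c; rewrite ?inE ?cI // /h cC.
  apply/imsetP; exists (s y); first by rewrite !inE syNC syJ orbT.
  by rewrite /h (negPf syNC) permK.
- move=> x y xD yD; rewrite /h.
  case: ifPn => xC; case: ifPn => yC.
  + exact: perm_inj.
  + by move/(h_cross _ _ xD xC yC).
  + by move/esym/(h_cross _ _ yD yC xC).
  + exact: perm_inj.
- move=> x xD; rewrite /h; case: ifPn => xC; first exact/e_s/D_C.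
  by rewrite e_sym -{2}[x](permKV s) e_s ?J_inv ?notC_J.
Qed.

Lemma conform_mxE (R : Type) (k a b : nat) (B : 'M[R]_k) (M : 'M[R]_(a, b))
    (ea : k = a) (eb : k = b) i j :
  conform_mx B M i j = M (cast_ord ea i) (cast_ord eb j).
Proof.
by case: a / ea M => M; case: b / eb M => M; rewrite conform_mx_id !cast_ord_id.
Qed.

(** Nonnegative summands cannot cancel, so only the pattern of nonzero entries matters. *)
Lemma permanent_neq0P (R : numDomainType) (m : nat) (B : 'M[R]_m) :
    (forall i j, 0 <= B i j) ->
  reflect (exists s : 'S_m, forall i, B i (s i) != 0) (permanent B != 0).
Proof.
move=> B_ge0; rewrite /permanent psumr_eq0; last first.
  by move=> s _; apply: prodr_ge0.
rewrite -has_predC; apply: (iffP hasP) => [[s _ /= /prodf_neq0 s_neq0]|[s s_neq0]].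
  by exists s => i; apply: s_neq0.
by exists s; rewrite ?mem_index_enum //=; apply/prodf_neq0.
Qed.

Lemma conform_mx_ge0 (R : numDomainType) (k a b : nat) (M : 'M[R]_(a, b)) :
    (forall i j, 0 <= M i j) ->
  forall i j, 0 <= conform_mx (0 : 'M[R]_k) M i j.
Proof.
move=> M_ge0 i j; rewrite /conform_mx.
by case: eqP => [?|_]; [case: eqP => [?|_] |]; rewrite ?castmxE ?mxE.
Qed.

Section PermanentalRank.
Variables (R : numDomainType) (n : nat) (A : 'M[R]_n).
Hypothesis A_ge0 : forall i j, 0 <= A i j.

Lemma submx_of_ge0 (I J : {set 'I_n}) i j : 0 <= submx_of A I J i j.
Proof. by rewrite mxE. Qed.

Lemma matching_has_per_submx (D : {set 'I_n}) (h : 'I_n -> 'I_n) :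
    {in D &, injective h} -> {in D, forall i, A i (h i) != 0} ->
  has_per_submx A #|D|.
Proof.
move=> h_inj h_neq0; pose J := h @: D.
have cardJ : #|J| = #|D| by apply: card_in_imset.
apply/existsP; exists D; apply/existsP; exists J.
rewrite eqxx (introT eqP cardJ) /=.
have memJ (i : 'I_#|D|) : h (enum_val i) \in J by rewrite imset_f ?enum_valP.
(* [t] is [h] read through the enumerations of [D] and [J]. *)
pose t (i : 'I_#|D|) := cast_ord cardJ (enum_rank_in (memJ i) (h (enum_val i))).
have tE i : enum_val (cast_ord (esym cardJ) (t i)) = h (enum_val i).
  by rewrite cast_ordK enum_rankK_in.
have t_inj : injective t.
  move=> i j /(congr1 (fun k => enum_val (cast_ord (esym cardJ) k))).
  by rewrite !tE => /h_inj/enum_val_inj; apply; apply: enum_valP.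
apply/permanent_neq0P; first exact/conform_mx_ge0/submx_of_ge0.
exists (perm t_inj) => i; rewrite permE (conform_mxE _ _ erefl (esym cardJ)).
by rewrite mxE tE cast_ord_id h_neq0 ?enum_valP.
Qed.

Lemma has_per_submx_matching (k : nat) : has_per_submx A k ->
  exists (s : 'S_n) (I : {set 'I_n}),
    #|I| = k /\ {in I, forall i, A i (s i) != 0}.
Proof.
case/existsP => I /existsP[J /and3P[/eqP cI /eqP cJ]].
case/permanent_neq0P; first exact/conform_mx_ge0/submx_of_ge0.
move=> t t_neq0; pose f (i : 'I_k) := enum_val (cast_ord (esym cI) i).
pose g (i : 'I_k) := enum_val (cast_ord (esym cJ) (t i)).
have [||s sE] := @perm_extend_inj _ _ f g.
- by move=> i j /enum_val_inj/cast_ord_inj.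
- by move=> i j /enum_val_inj/cast_ord_inj/perm_inj.
exists s, I; split=> // x xI.
have -> : x = f (cast_ord cI (enum_rank_in xI x)).
  by rewrite /f cast_ordK enum_rankK_in.
have := t_neq0 (cast_ord cI (enum_rank_in xI x)).
by rewrite sE (conform_mxE _ _ (esym cI) (esym cJ)) mxE.
Qed.

Lemma matching_leq_per_rank (D : {set 'I_n}) (h : 'I_n -> 'I_n) :
    {in D &, injective h} -> {in D, forall i, A i (h i) != 0} ->
  (#|D| <= per_rank A)%N.
Proof.
move=> h_inj h_neq0; have D_le : (#|D| < n.+1)%N.
  by rewrite ltnS -[leqRHS]card_ord max_card.
exact: (@leq_bigmax_cond _ _ _ (Ordinal D_le) (matching_has_per_submx h_inj h_neq0)).
Qed.

Lemma has_per_submx_rank : has_per_submx A (per_rank A).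
Proof.
have has0 : has_per_submx A 0.
  rewrite -(@cards0 'I_n); apply: (@matching_has_per_submx set0 id).
    exact: in2W.
  by move=> i; rewrite inE.
pose P := [pred k : 'I_n.+1 | has_per_submx A k].
have P_gt0 : (0 < #|P|)%N by apply/card_gt0P; exists ord0.
have [k Pk maxE] := eq_bigmax_cond (@nat_of_ord n.+1) P_gt0.
have -> : per_rank A = k by rewrite -maxE; apply: eq_bigl.
exact: Pk.
Qed.

Definition per_support (s : 'S_n) := [set i | A i (s i) != 0].

Lemma per_support_leq_rank (s : 'S_n) : (#|per_support s| <= per_rank A)%N.
Proof.
apply: (@matching_leq_per_rank _ s); first by apply: in2W; apply: perm_inj.
by move=> i; rewrite inE.
Qed.

Lemma principal_per_rank : A^T = A ->
  exists s : 'S_n, #|per_support s| = per_rank A /\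
    {in ~: per_support s, forall i, s i = i}.
Proof.
move=> A_sym; have [s [I [cI s_neq0]]] := has_per_submx_matching has_per_submx_rank.
have [i j||D [h [ID IhD h_inj h_neq0]]] :=
    @symmetric_matching_cover _ [rel i j | A i j != 0] s I.
- by rewrite /= -{1}A_sym mxE.
- exact: s_neq0.
(* Maximality of [I] forces [D = I]; since the image of [h] covers [I], [h] then permutes [D]. *)
have cD : (#|D| <= #|I|)%N by rewrite cI (matching_leq_per_rank h_inj).
have /eqP ID_eq : I == D by rewrite eqEcard ID cD.
have hD : h @: D = D.
  by apply/esym/eqP; rewrite eqEcard -{1}ID_eq IhD leq_imset_card.
pose f x := if x \in D then h x else x.
have hDx x : x \in D -> h x \in D by move=> xD; rewrite -[in _ \in D]hD imset_f.
have f_inj : injective f.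
  move=> x y; rewrite /f; case: ifPn => xD; case: ifPn => yD //.
  + exact: h_inj.
  + by move=> hxy; rewrite -hxy hDx in yD.
  + by move=> hxy; rewrite hxy hDx in xD.
have D_sub : D \subset per_support (perm f_inj).
  by apply/subsetP => x xD; rewrite inE permE /f xD; apply: h_neq0.
(* A fixed point outside [D] with nonzero diagonal entry would enlarge the support beyond [D]; the
   rank bound excludes this. *)
exists (perm f_inj); split.
  apply/eqP; rewrite eqn_leq per_support_leq_rank -cI ID_eq.
  exact: subset_leq_card.
move=> x; rewrite inE permE /f => xNS.
by case: ifPn => // xD; rewrite (subsetP D_sub) in xNS.
Qed.

(** Fixed points in the support contribute [A i i - X], so this is a polynomial, but each factor has
    a nonzero constant term. *)
Definition per_poly_cofactor (s : 'S_n) : {poly R} :=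
  \prod_(i in per_support s) (map_mx polyC A - 'X%:M) i (s i).

Lemma per_poly_cofactor0 (s : 'S_n) :
  (per_poly_cofactor s).[0] = \prod_(i in per_support s) A i (s i).
Proof.
rewrite horner_prod; apply: eq_bigr => i _.
by rewrite !mxE !hornerE hornerMn hornerX mul0rn subr0.
Qed.

(** Off the support, the entry is [-X] at a fixed point of [s] and [0] elsewhere. *)
Lemma per_poly_term (s : 'S_n) : \prod_i (map_mx polyC A - 'X%:M) i (s i) =
  if [forall (i | i \notin per_support s), s i == i]
  then (- 'X) ^+ (n - #|per_support s|) * per_poly_cofactor s else 0.
Proof.
case: ifPn => [/forall_inP s_fix | ]; last first.
  rewrite negb_forall_in => /exists_inP[i iNS s_i].
  apply/eqP/prodf_eq0; exists i => //.
  move: iNS; rewrite inE negbK => /eqP Ai0.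
  by rewrite !mxE Ai0 [i == _]eq_sym (negPf s_i) mulr0n subr0.
rewrite (bigID [in per_support s]) /= mulrC; congr (_ * _).
have -> : (n - #|per_support s|)%N = #|~: per_support s|.
  by rewrite [RHS]cardsCs setCK card_ord.
rewrite -prodr_const; apply: eq_big => [i | i iNS]; first by rewrite !inE.
have /eqP s_i := s_fix i iNS; move: iNS; rewrite inE negbK => /eqP Ai0.
by rewrite !mxE Ai0 s_i eqxx mulr1n sub0r.
Qed.

Lemma per_poly_factor : A^T = A -> exists2 q : {poly R},
  per_poly A = 'X ^+ (n - per_rank A) * q & q.[0] != 0.
Proof.
move=> A_sym; set r := per_rank A.
pose fixing (s : 'S_n) := [forall (i | i \notin per_support s), s i == i].
(* No support exceeds [r], so [(- 'X) ^+ (n - r)] divides every term; its sign goes into [q]. *)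
pose q := (- 1) ^+ (n - r) *
  \sum_(s | fixing s) (- 'X) ^+ (r - #|per_support s|) * per_poly_cofactor s.
have r_le : (r <= n)%N by apply/bigmax_leqP => k _; rewrite -ltnS.
exists q.
  rewrite mulrA -exprMn mulrN1 mulr_sumr [RHS]big_mkcond; apply: eq_bigr => s _.
  rewrite per_poly_term -/(fixing s); case: ifP => // _.
  rewrite mulrA -exprD; congr ((- 'X) ^+ _ * _).
  by rewrite addnBA ?per_support_leq_rank // subnK.
rewrite /q hornerM horner_exp hornerN -polyC1 hornerC mulf_eq0 signr_eq0 /=.
rewrite horner_sum.
have term_ge0 (s : 'S_n) :
    0 <= ((- 'X) ^+ (r - #|per_support s|) * per_poly_cofactor s).[0].
  rewrite hornerM horner_exp hornerN hornerX oppr0 per_poly_cofactor0.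
  by rewrite mulr_ge0 ?exprn_ge0 ?prodr_ge0.
rewrite psumr_eq0; last by move=> s _; apply: term_ge0.
(* The values at [0] are nonnegative, so one nonzero value suffices: a support of size [r] leaves no
   power of [X]. *)
have [s [cs s_fix]] := principal_per_rank A_sym.
rewrite -has_predC; apply/hasP; exists s; first exact: mem_index_enum.
rewrite /=; have -> : fixing s.
  by apply/forall_inP => i iNS; rewrite s_fix // inE.
rewrite /= cs subnn mul1r per_poly_cofactor0.
by apply/prodf_neq0 => i; rewrite inE.
Qed.

End PermanentalRank.

Theorem theorem3 (R : realType) (n : nat) (A : 'M[R]_n)
    (A_sym : A^T = A) (A_ge0 : forall i j, 0 <= A i j) :
  (per_rank A + per_nullity A)%N = n.
Proof.
have [q perE q0] := per_poly_factor A_ge0 A_sym.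
rewrite /per_nullity perE mupMl ?rootE // -['X]subr0 mup_XsubCX eqxx.
by rewrite subnKC //; apply/bigmax_leqP => k _; rewrite -ltnS.
Qed.
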